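(* Let $X$ be a separable Fréchet space, let $T$ be a linear operator acting on $X$ (not necessarily continuous or everywhere defined), let $\mathcal F=\bigcup_{\delta\in D}\mathcal F_\delta$, $\mathcal F_\delta=\bigcap_{\nu\in M}\mathcal F_{\delta,\nu}$, be an upper Furstenberg family, and let $C\in L(X)$ be injective. Suppose that there are two dense subsets $X_0$ and $Y_0$ of $X$ and mappings $S_n:Y_0\to R(C)$ ($n\in\mathbb N$) such that the following condition holds: for every $y\in Y_0$ and $\epsilon>0$, there exist $A\in\mathcal F$ and $\delta\in D$ such that: (i) for every $x\in X_0$, there exists $B\in\mathcal F_\delta$ such that $B\subseteq A$ and, for every $n\in B$, $\|T^nCx\|<\epsilon$; (ii) the series $\sum_{n\in A}S_ny$ converges; (iii) for every $m\in A$, we have $\bigl\|T^m\sum_{n\in A}S_ny-y\bigr\|<\epsilon$; (iv) $R(C)\subseteq D_\infty(T)$ and $T^nC\in L(X)$ for all $n\in\mathbb N$. Then the operator $T$ is $\mathcal F$-hypercyclic, and the set consisting of all $\mathcal F$-hypercyclic vectors of $T$ is residual in $[R(C)]$.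
   Context: The topology of the (real or complex) Fréchet space $X$ is induced by an increasing fundamental system of seminorms $(p_n)_{n\in\mathbb N}$; $\|x\|:=d(x,0)=\sum_{n\ge1}2^{-n}\frac{p_n(x)}{1+p_n(x)}$. $L(X)$ is the space of continuous linear operators on $X$. A linear operator $T$ on $X$ has a domain $D(T)\subseteq X$, and $D_\infty(T)=\bigcap_{k\in\mathbb N}D(T^k)$. $R(C)$ is the range of $C$; $[R(C)]$ denotes $R(C)$ with the Fréchet topology induced by the seminorms $y\mapsto p_n(C^{-1}y)$, $n\in\mathbb N$. A non-empty collection $\mathcal F$ of subsets of $\mathbb N$ is a Furstenberg family if $A\in\mathcal F$, $A\subseteq B\subseteq\mathbb N$ imply $B\in\mathcal F$; it is proper if $\emptyset\notin\mathcal F$. An upper Furstenberg family is a proper Furstenberg family $\mathcal F$ such that: (a) there are a set $D$ and a countable set $M$ with $\mathcal F=\bigcup_{\delta\in D}\bigcap_{\nu\in M}\mathcal F_{\delta,\nu}$, where for all $\delta\in D$, $\nu\in M$: if $A\in\mathcal F_{\delta,\nu}$, then there is a finite $F\subseteq\mathbb N$ such that $A\cap F\subseteq B$ implies $B\in\mathcal F_{\delta,\nu}$; (b) if $A\in\mathcal F$, then there is $\delta\in D$ such that for every $n\in\mathbb N$, $A-n:=\{k-n:k\in A,\ k>n\}\in\mathcal F_\delta:=\bigcap_{\nu\in M}\mathcal F_{\delta,\nu}$. A vector $x\in D_\infty(T)$ is an $\mathcal F$-hypercyclic vector of $T$ if $\{n\in\mathbb N:T^nx\in V\}\in\mathcal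 F$ for every open non-empty $V\subseteq X$; $T$ is $\mathcal F$-hypercyclic if it has an $\mathcal F$-hypercyclic vector. A set of vectors is residual in $[R(C)]$ if it contains a countable intersection of dense open subsets of $[R(C)]$.
   Formalization: In (ii) the sum of the series over A is additionally required to lie in R(C) (automatic if the series converges in [R(C)]); with convergence in X alone and the sum merely in the domain of T^m, the claim is false. *)

(* Defs.v *)
From HB Require Import structures.
From mathcomp Require Import all_boot all_order all_algebra.
From mathcomp Require Import all_classical all_reals all_analysis.
From mathcomp Require Import complex.

Set Implicit Arguments.
Unset Strict Implicit.
Unset Printing Implicit Defensive.

Import Order.TTheory GRing.Theory Num.Theory.
Import numFieldNormedType.Exports.

Local Open Scope classical_set_scope.
Local Open Scope ring_scope.

(* The ground field is the reals or the complex numbers. Seminorms are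
   R-valued in both cases, so the modulus is R-valued too. *)
Inductive scalar_kind := RealScalars | ComplexScalars.

Definition scalars (R : realType) (k : scalar_kind) : numFieldType :=
  match k with RealScalars => R | ComplexScalars => complex R end.

Definition modulus (R : realType) (k : scalar_kind) : scalars R k -> R :=
  match k return scalars R k -> R with
  | RealScalars => fun a : R => `|a|
  | ComplexScalars => fun a : complex R => complex.Re `|a|
  end.

(* The open sets of the topology generated by a sequence of
   pseudodistances, e.g. d n x y = p n (y - x) for seminorms p n. *)
Definition pseudodist_open (R : realType) (V : Type) (d : nat -> V -> V -> R)
    (U : set V) : Prop :=
  forall x, U x -> exists n (e : R), 0 < e /\
    forall y, (forall k, (k <= n)%N -> d k x y < e) -> U y.

Section Frechet.
Context (R : realType) (k : scalar_kind).
Local Notation K := (scalars R k).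

Definition seminorm (X : lmodType K) (q : X -> R) : Prop :=
  (forall x y, q (x + y) <= q x + q y) /\
  (forall (a : K) x, q (a *: x) = modulus a * q x).

(* Sequences are numbered from 0, so that p n stands for p_(n+1).
   Completeness is expressed by Cauchy sequences, the topology being
   metrizable. *)
Record frechet (X : topologicalLmodType K) (p : nat -> X -> R) : Prop := {
  frechet_seminorm : forall n, seminorm (p n) ;
  frechet_increasing : forall n x, p n x <= p n.+1 x ;
  frechet_separated : forall x, (forall n, p n x = 0) -> x = 0 ;
  frechet_topology : forall U : set X,
    open U <-> pseudodist_open (fun n x y => p n (y - x)) U ;
  frechet_complete : forall u : nat -> X,
    (forall n (e : R), 0 < e -> exists N, forall i j,
       (N <= i)%N -> (N <= j)%N -> p n (u i - u j) < e) ->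
    exists l : X, u @ \oo --> l }.

(* The paranorm d(x, 0); the weight of p n is 2^-(n+1) because of the
   numbering from 0. *)
Definition fnorm (X : lmodType K) (p : nat -> X -> R) (x : X) : R :=
  limn (series (fun n => 2 ^- n.+1 * (p n x / (1 + p n x)))).

Definition continuous_linear (X : topologicalLmodType K) (f : X -> X) : Prop :=
  linear f /\ continuous f.

(* A linear operator defined on a linear subspace; the values of [op]
   outside [dom] carry no meaning. *)
Record linear_operator (X : lmodType K) := LinearOperator {
  dom : set X ;
  op :> X -> X ;
  dom0 : dom 0 ;
  dom_linear : forall (a : K) x y, dom x -> dom y -> dom (a *: x + y) ;
  op_linear : forall (a : K) x y, dom x -> dom y ->
    op (a *: x + y) = a *: op x + op y }.

Fixpoint dom_iter (X : lmodType K) (T : linear_operator X) (n : nat) : set X :=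
  if n is m.+1 then [set x | dom_iter T m x /\ dom T (iter m T x)] else setT.

Definition dom_infty (X : lmodType K) (T : linear_operator X) : set X :=
  \bigcap_n dom_iter T n.

(* The space [R(C)], topologized by the seminorms y |-> p n (C^-1 y). *)
Definition range_space (X : topologicalLmodType K) (p : nat -> X -> R)
  (C : X -> X) : Type := {y : X | range C y}.

End Frechet.

Section RangeTopology.
Context (R : realType) (k : scalar_kind) (X : topologicalLmodType (scalars R k)).
Context (p : nat -> X -> R) (C : X -> X).

Definition range_pseudodist (n : nat) (y z : range_space p C) : R :=
  p n ('pinv_(fun=> 0) setT C (sval z - sval y)).

Definition range_open : set (set (range_space p C)) :=
  pseudodist_open range_pseudodist.

Lemma range_openT : range_open setT.
Proof. by move=> x _; exists 0%N, 1; split. Qed.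

Lemma range_openI (A B : set (range_space p C)) :
  range_open A -> range_open B -> range_open (A `&` B).
Proof.
move=> oA oB x [Ax Bx].
have [n [e [e0 Ae]]] := oA x Ax; have [m [f [f0 Bf]]] := oB x Bx.
exists (maxn n m), (Num.min e f); split; first by rewrite lt_min e0.
move=> y xy; split.
  apply: Ae => i ni.
  have := xy i (leq_trans ni (leq_maxl _ _)).
  by rewrite lt_min => /andP[].
apply: Bf => i mi.
have := xy i (leq_trans mi (leq_maxr _ _)).
by rewrite lt_min => /andP[].
Qed.

Lemma range_open_bigU (I : Type) (f : I -> set (range_space p C)) :
  (forall i, range_open (f i)) -> range_open (\bigcup_i f i).
Proof.
move=> of_ x [i _ fix_]; have [n [e [e0 h]]] := of_ i x fix_.
by exists n, e; split=> // y /h; exists i.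
Qed.

HB.instance Definition _ := gen_eqMixin (range_space p C).
HB.instance Definition _ := gen_choiceMixin (range_space p C).
HB.instance Definition _ := isOpenTopological.Build (range_space p C)
  range_openT range_openI range_open_bigU.

End RangeTopology.

Definition separable (X : topologicalType) : Prop :=
  exists2 Q : set X, countable Q & dense Q.

Definition residual (Y : topologicalType) (A : set Y) : Prop :=
  exists2 U : nat -> set Y,
    forall n, open (U n) /\ dense (U n) & \bigcap_n U n `<=` A.

(* Families of subsets of the set N = {1, 2, 3, ...}. *)
Definition Npos : set nat := [set n | (0 < n)%N].

Definition furstenberg_family (F : set (set nat)) : Prop :=
  [/\ F !=set0, (forall A, F A -> A `<=` Npos) &
      forall A B, F A -> A `<=` B -> B `<=` Npos -> F B].

Definition proper_family (F : set (set nat)) : Prop := ~ F set0.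

Definition left_shift (A : set nat) (n : nat) : set nat :=
  [set (k - n)%N | k in [set k | A k /\ (n < k)%N]].

Definition family_delta (D M : Type) (Fam : D -> M -> set (set nat)) (delta : D)
    : set (set nat) :=
  [set A | A `<=` Npos /\ forall nu, Fam delta nu A].

Record upper_furstenberg (D M : Type) (Fam : D -> M -> set (set nat))
    (F : set (set nat)) : Prop := {
  upper_furstenberg_family : furstenberg_family F ;
  upper_furstenberg_proper : proper_family F ;
  upper_furstenberg_countable : countable [set: M] ;
  upper_furstenberg_sub :
    forall delta nu A, Fam delta nu A -> A `<=` Npos ;
  upper_furstenberg_decomposition : F = \bigcup_delta family_delta Fam delta ;
  upper_furstenberg_finite : forall delta nu A, Fam delta nu A ->
    exists G : set nat, [/\ finite_set G, G `<=` Npos &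
      forall B, B `<=` Npos -> A `&` G `<=` B -> Fam delta nu B] ;
  upper_furstenberg_shift : forall A, F A -> exists delta : D,
    forall n, Npos n -> family_delta Fam delta (left_shift A n) }.

Section Hypercyclicity.
Context (R : realType) (k : scalar_kind) (X : topologicalLmodType (scalars R k)).
Context (F : set (set nat)) (T : linear_operator X).

Definition hypercyclic_vector (x : X) : Prop :=
  dom_infty T x /\
  forall V : set X, open V -> V !=set0 ->
    F [set n | Npos n /\ V (iter n T x)].

Definition hypercyclic : Prop := exists x, hypercyclic_vector x.

End Hypercyclicity.

(* Main.v *)
(* For an open set V write N(x, V) for the set of n >= 1 with T^n C x in V.
   If V is a ball around a point y of Y0, the hypotheses give a delta that
   depends on V only, a point c with T^n C c close to y for all n in A, and, for
   every x0 in X0, a set B in F_delta contained in A and such that T^n C x0 is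
   small for n in B, whence B is contained in N(x0 + c, V). As X0 + c is dense,
   so is the set of all x with N(x, V) in F_delta, a fortiori the set of all x
   with N(x, V) in F_(delta, nu). The latter is moreover open because membership
   in F_(delta, nu) is decided by finitely many of the continuous maps T^n C.
   Letting V run through countably many balls that refine every open set and nu
   through M, Baire's theorem yields the claim in X, and C : X -> [R(C)] is a
   homeomorphism. *)
Require Import Defs.
From mathcomp Require Import all_boot all_order all_algebra.
From mathcomp Require Import all_classical all_reals all_analysis.
From mathcomp Require Import lra complex.
Import Order.TTheory GRing.Theory Num.Theory.
Import numFieldNormedType.Exports.
Local Open Scope classical_set_scope.
Local Open Scope ring_scope.

(** * Seminorms and the paranorm *)

Lemma modulus0 (R : realType) (k : scalar_kind) : modulus (0 : scalars R k) = 0.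
Proof.
by case: k; [exact: (@normr0 R R) | rewrite /modulus (@normr0 R[i] R[i])].
Qed.

Lemma modulusN1 (R : realType) (k : scalar_kind) :
  modulus (-1 : scalars R k) = 1.
Proof.
by case: k; [exact: (@normrN1 R) | rewrite /modulus (@normrN1 R[i])].
Qed.

Section Seminorm.
Context {R : realType} {k : scalar_kind} {X : lmodType (scalars R k)}.
Context {q : X -> R} (hq : seminorm q).

Lemma seminorm0 : q 0 = 0.
Proof. by rewrite -(scale0r 0) hq.2 modulus0 mul0r. Qed.

Lemma seminormN x : q (- x) = q x.
Proof. by rewrite -scaleN1r hq.2 modulusN1 mul1r. Qed.

Lemma seminorm_ge0 x : 0 <= q x.
Proof. by have := hq.1 x (- x); rewrite subrr seminorm0 seminormN; lra. Qed.

Lemma seminorm_distC x y : q (x - y) = q (y - x).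
Proof. by rewrite -seminormN opprB. Qed.

Lemma seminorm_triangle y x z : q (x - z) <= q (x - y) + q (y - z).
Proof. by rewrite -{1}(subrK y x) -addrA; exact: hq.1. Qed.

End Seminorm.

(** One term of the series is at most its sum, and [t / (1 + t)] increases with [t]; hence [d] is
    the value of the [n]-th term at [p n x = e]. Comparison with a geometric series gives the
    convergence that makes the limit in [fnorm] bound its partial sums. *)
Lemma fnorm_lt (R : realType) (k : scalar_kind) (X : lmodType (scalars R k))
    (p : nat -> X -> R) (n : nat) (e : R) :
  (forall i, seminorm (p i)) -> 0 < e ->
  exists2 d : R, 0 < d & forall x, fnorm p x < d -> p n x < e.
Proof.
move=> sp e0; exists (2 ^- n.+1 * (e / (1 + e))).
  by rewrite mulr_gt0 ?invr_gt0 ?exprn_gt0 ?divr_gt0 //; lra.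
move=> x; apply: contraTT; rewrite -!leNgt => epx.
have p0 i : 0 <= p i x := seminorm_ge0 (sp i) x.
pose u i : R := 2 ^- i.+1 * (p i x / (1 + p i x)).
have u0 i : 0 <= u i.
  have pi0 := p0 i.
  by rewrite /u mulr_ge0 ?invr_ge0 ?exprn_ge0 ?divr_ge0 //; lra.
have cu : cvgn (series u).
  apply: (@series_le_cvg _ _ (geometric 2^-1 2^-1)) => //.
  - by move=> i; rewrite /geometric /= mulr_ge0 ?invr_ge0 ?exprn_ge0.
  - move=> i; rewrite /u /geometric /= -exprVn exprS ler_piMr //.
    by have pi0 := p0 i; rewrite ler_pdivrMr; lra.
  - apply: is_cvg_geometric_series.
    by rewrite ger0_norm ?invr_ge0 // invf_lt1 // ltr1n.
have nu : nondecreasing_seq (series u) by exact: nondecreasing_series.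
apply: le_trans (nondecreasing_cvgn_le nu cu n.+1).
rewrite seriesEnat /= big_nat_recr //=.
apply: (@le_trans _ _ (u n)); last by rewrite lerDr; apply: sumr_ge0.
rewrite /u ler_pM2l ?invr_gt0 ?exprn_gt0 //.
have pn0 := p0 n.
by rewrite ler_pdivrMr; [rewrite mulrAC ler_pdivlMr; nra|lra].
Qed.

Lemma invS_lt (R : archiRealFieldType) (e : R) (n : nat) : 0 < e ->
  exists2 m, (n <= m)%N & m.+1%:R^-1 < e.
Proof.
move=> e0; have [N _ hN] := near_infty_natSinv_lt (PosNum e0).
by exists (maxn n N); [exact: leq_maxl | apply: hN; exact: leq_maxr].
Qed.

(** * Balls, Baire's theorem and dense sequences in a Fréchet space *)

Section Frechet.
Context {R : realType} {k : scalar_kind} {X : topologicalLmodType (scalars R k)}.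
Context {p : nat -> X -> R} (hX : frechet p).

Let sp n : seminorm (p n) := frechet_seminorm hX n.

Lemma frechet_le n m x : (n <= m)%N -> p n x <= p m x.
Proof.
elim: m => [|m IH]; first by rewrite leqn0 => /eqP ->.
rewrite leq_eqVlt => /orP[/eqP -> //|/IH h].
exact: le_trans h (frechet_increasing hX m x).
Qed.

Definition frechet_ball n (x : X) (e : R) : set X := [set y | p n (y - x) < e].

Lemma frechet_ball_center n x e : 0 < e -> frechet_ball n x e x.
Proof. by rewrite /frechet_ball /= subrr (seminorm0 (sp n)). Qed.

Lemma open_frechet_ball n x e : open (frechet_ball n x e).
Proof.
apply/(frechet_topology hX) => y /= yx.
exists n, (e - p n (y - x)); split; first by rewrite subr_gt0.
move=> z /(_ n (leqnn n)) zy /=.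
by apply: le_lt_trans (seminorm_triangle (sp n) y _ _) _; lra.
Qed.

Lemma open_sub_frechet_ball (U : set X) x : open U -> U x ->
  exists n (e : R), 0 < e /\ frechet_ball n x e `<=` U.
Proof.
move=> /(frechet_topology hX) oU Ux; have [n [e [e0 eU]]] := oU x Ux.
exists n, e; split=> // y xy; apply: eU => i /frechet_le h.
exact: le_lt_trans (h _) xy.
Qed.

(** Nested closed balls are chosen, each inside the next [O n]. Their radii tend to 0 while their
    seminorm indices tend to infinity, so the centres are Cauchy for every seminorm, and their limit
    lies in all the balls. *)
Lemma frechet_baire (O : nat -> set X) :
  (forall n, open (O n) /\ dense (O n)) -> exists x, forall n, O n x.
Proof.
move=> hO.
pose cball (s : X * nat * R) : set X := [set y | p s.1.2 (y - s.1.1) <= s.2].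
(* A state is a centre, a seminorm index and a radius. Positivity of the radius is a premise inside
   the existential, so that [choice] yields a total function. *)
have step (ns : nat * (X * nat * R)) : exists t : X * nat * R,
    0 < ns.2.2 -> [/\ 0 < t.2, t.2 <= ns.1.+1%:R^-1, (ns.1 <= t.1.2)%N &
      cball t `<=` cball ns.2 `&` O ns.1].
  case: ns => n [[x m] r] /=.
  have [r0|_] := ltP 0 r; last by exists (x, m, r).
  have [|y [yb yO]] := (hO n).2 (frechet_ball m x r) _ (open_frechet_ball _ _ _).
    by exists x; exact: frechet_ball_center.
  have [i [e [e0 eU]]] := open_sub_frechet_ball _ _
    (openI (open_frechet_ball m x r) (hO n).1) (conj yb yO).
  (* Halving [e] puts the closed ball inside the open one. *)
  exists (y, maxn i n, Num.min (e / 2) n.+1%:R^-1) => _ /=; split.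
  - by rewrite lt_min invr_gt0 ltr0n andbT; lra.
  - by rewrite ge_min lexx orbT.
  - exact: leq_maxr.
  - move=> z; rewrite /cball /= le_min => /andP[ze _].
    have /eU[zx Oz] : frechet_ball i y e z.
      rewrite /frechet_ball /=.
      have := frechet_le i (maxn i n) (z - y) (leq_maxl _ _); lra.
    by split=> //; exact: ltW.
have [f hf] := choice step.
pose s := fix s n := if n is m.+1 then f (m, s m) else (0, 0%N, 1) : X * nat * R.
have s0 n : 0 < (s n).2.
  by elim: n => [|n IH] /=; [exact: ltr01 | have [] := hf (n, s n) IH].
have sS n := hf (n, s n) (s0 n).
have sub n m : (n <= m)%N -> cball (s m) `<=` cball (s n).
  elim: m => [|m IH]; first by rewrite leqn0 => /eqP ->.
  rewrite leq_eqVlt => /orP[/eqP -> //|/IH h] z.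
  by have [_ _ _ hs] := sS m => /hs[/h].
pose u n := (s n).1.1.
have uball n m : (n <= m)%N -> cball (s n) (u m).
  move=> nm; apply: (sub _ _ nm).
  by rewrite /cball /= subrr (seminorm0 (sp _)) ltW.
have [|l ul] := frechet_complete hX (u := u).
  move=> n e e0.
  have [N nN Ne] := invS_lt _ (e / 2) n (divr_gt0 e0 (ltr0Sn _ 1)).
  (* Step [N] produces ball [N.+1], whose radius is at most [1 / (N + 1)] and whose index is at
     least [N]. *)
  exists N.+1 => i j Ni Nj.
  have [_ rN mN _] := sS N.
  apply: le_lt_trans (frechet_le _ _ _ (leq_trans nN mN)) _.
  apply: le_lt_trans (seminorm_triangle (sp _) (u N.+1) _ _) _.
  have rN' : (s N.+1).2 < e / 2 := le_lt_trans rN Ne.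
  have ui : p (s N.+1).1.2 (u i - u N.+1) <= (s N.+1).2 := uball _ _ Ni.
  have uj : p (s N.+1).1.2 (u j - u N.+1) <= (s N.+1).2 := uball _ _ Nj.
  rewrite (seminorm_distC (sp _)) in uj.
  by rewrite [e]splitr ltrD //; [exact: le_lt_trans ui rN'
                                | exact: le_lt_trans uj rN'].
have lball n : cball (s n) l.
  rewrite /cball /=; apply/ler_addgt0Pr => e e0.
  have /ul[N _ hN] : nbhs l (frechet_ball (s n).1.2 l e).
    by apply: open_nbhs_nbhs; split; [exact: open_frechet_ball
                                     | exact: frechet_ball_center].
  have lu := hN (maxn n N) (leq_maxr _ _).
  have un := uball _ _ (leq_maxl n N).
  rewrite /frechet_ball /cball /= in lu un.
  rewrite (seminorm_distC (sp _)) in lu.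
  have := seminorm_triangle (sp (s n).1.2) (u (maxn n N)) l (s n).1.1; lra.
exists l => n; have [_ _ _ hs] := sS n.
by have /hs[] := lball n.+1.
Qed.

(** Each point of a countable dense set is approximated by points of [Y] in every seminorm and to
    every precision [1 / (i + 1)]; these approximants are countably many. *)
Lemma frechet_dense_sequence (Y : set X) : separable X -> dense Y ->
  exists y : nat -> X, (forall j, Y (y j)) /\ dense (range y).
Proof.
move=> [Q /countable_injP[f finj] Qd] Yd.
(* [g] inverts the enumeration [f] on [Q], with value 0 off the image. *)
have /choice[g hg] (m : nat) : exists q, forall q', Q q' -> f q' = m -> q' = q.
  have [[q [Qq fq]]|h] := pselect (exists q, Q q /\ f q = m).
    by exists q => q' Qq' fq'; apply: finj; rewrite ?inE // fq'.
  by exists 0 => q Qq fq; case: h; exists q.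
have /choice[y hy] (j : nat * nat * nat) :
    exists y, Y y /\ frechet_ball j.1.2 (g j.1.1) j.2.+1%:R^-1 y.
  have [|y [yb Yy]] := Yd (frechet_ball j.1.2 (g j.1.1) j.2.+1%:R^-1) _
    (open_frechet_ball _ _ _); last by exists y.
  by exists (g j.1.1); apply: frechet_ball_center; rewrite invr_gt0.
exists (fun m => y (odflt (0, 0, 0)%N (unpickle m))); split.
  by move=> m; have [] := hy (odflt (0, 0, 0)%N (unpickle m)).
move=> O [v Ov] oO; have [n [e [e0 eO]]] := open_sub_frechet_ball _ _ oO Ov.
have e20 : 0 < e / 2 by lra.
have [|q [qv Qq]] := Qd (frechet_ball n v (e / 2)) _ (open_frechet_ball _ _ _).
  by exists v; exact: frechet_ball_center.
have [m _ me] := invS_lt _ _ 0 e20.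
exists (y (f q, n, m)); split; last first.
  by exists (pickle (f q, n, m)); rewrite // pickleK.
apply: eO; have [_] := hy (f q, n, m).
rewrite /frechet_ball /= in qv *; rewrite -(hg _ _ Qq erefl) => yq.
apply: le_lt_trans (seminorm_triangle (sp n) q _ _) _.
by rewrite [e]splitr ltrD // (lt_trans yq).
Qed.

End Frechet.

(** * Transfer between [X] and [[R(C)]] *)

Section RangeSpace.
Context {R : realType} {k : scalar_kind} {X : topologicalLmodType (scalars R k)}.
Context {p : nat -> X -> R} (hX : frechet p).
Context {C : X -> X} (Clin : linear C) (Cinj : injective C).

Definition to_range (x : X) : range_space p C := exist _ (C x) (imageT C x).

Lemma to_range_surj (y : range_space p C) : exists x, to_range x = y.
Proof.
case: y => y [x xT xy]; exists x; subst y.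
by congr exist; exact: Prop_irrelevance.
Qed.

Lemma range_pseudodistE n x y :
  range_pseudodist n (to_range x) (to_range y) = p n (y - x).
Proof.
rewrite /range_pseudodist /=.
have -> : C y - C x = C (y - x) by rewrite -scaleN1r addrC -Clin scaleN1r addrC.
by rewrite pinvKV ?inE // => a b _ _; exact: Cinj.
Qed.

(** [to_range] is a bijection that carries [p n (y - x)] to the [n]-th pseudodistance. *)
Lemma open_rangeP (U : set (range_space p C)) :
  open U <-> open (to_range @^-1` U).
Proof.
split=> [oU|/(frechet_topology hX) oU].
  apply/(frechet_topology hX) => x Ux; have [n [e [e0 eU]]] := oU _ Ux.
  exists n, e; split=> // y xy; apply: eU => i /xy.
  by rewrite range_pseudodistE.
move=> y; have [x <-] := to_range_surj y => Ux; have [n [e [e0 eU]]] := oU _ Ux.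
exists n, e; split=> // z; have [w <-] := to_range_surj z => xw.
by apply: eU => i /xw; rewrite range_pseudodistE.
Qed.

Lemma dense_range (U : set (range_space p C)) :
  dense (to_range @^-1` U) -> dense U.
Proof.
move=> dU O [y]; have [x <-] := to_range_surj y => Ox /open_rangeP oO.
by have [|w [Ow Uw]] := dU _ _ oO; [exists x | exists (to_range w)].
Qed.

End RangeSpace.

(** * Sets of return times *)

Section Hypercyclic.
Context {R : realType} {k : scalar_kind} {X : topologicalLmodType (scalars R k)}.
Context {D M : Type} {Fam : D -> M -> set (set nat)} {F : set (set nat)}.
Context (hF : upper_furstenberg Fam F).

(** Upward closure follows from finite determination, as [B] contains every finite part of [A]. *)
Lemma family_delta_sub delta A B : family_delta Fam delta A ->
  A `<=` B -> B `<=` Npos -> family_delta Fam delta B.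
Proof.
move=> [_ hA] AB BN; split=> // nu.
have [G [_ _ hG]] := upper_furstenberg_finite hF (hA nu).
by apply: hG => // n [/AB].
Qed.

(* Membership of [A] in [Fam delta nu] is already forced by a finite part of
   [A], so only finitely many of the maps [f n] matter. *)
Lemma open_return_set (f : nat -> X -> X) (V : set X) delta nu :
  (forall n, Npos n -> continuous (f n)) -> open V ->
  open [set x | Fam delta nu [set n | Npos n /\ V (f n x)]].
Proof.
move=> cf oV; rewrite openE => x /= hx.
have [G [/finite_fsetP[E GE] GN hG]] := upper_furstenberg_finite hF hx.
pose W n := [set x' | V (f n x) -> V (f n x')].
have : nbhs x (\bigcap_(n in G) W n).
  rewrite GE; apply: filter_bigI => n nE.
  have Nn : Npos n by apply: GN; rewrite GE.
  have [Vn|nV] := pselect (V (f n x)); last by apply: nearW => x' /nV.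
  have Vnbhs : nbhs (f n x) V by exact: open_nbhs_nbhs.
  have fV : nbhs x (f n @^-1` V) := cf n Nn x _ Vnbhs.
  by apply: filterS fV => x' Vx' _.
apply: filterS => x' Wx'; apply: hG => [n []//|n [[Nn Vn] Gn]].
by split=> //; exact: Wx'.
Qed.

End Hypercyclic.

Theorem theorem3p6 (R : realType) (k : scalar_kind)
  (X : topologicalLmodType (scalars R k)) (p : nat -> X -> R)
  (hX : frechet p) (hsep : separable X)
  (T : linear_operator X)
  (D M : Type) (Fam : D -> M -> set (set nat)) (F : set (set nat))
  (hF : upper_furstenberg Fam F)
  (C : X -> X) (hC : continuous_linear C) (Cinj : injective C)
  (X0 Y0 : set X) (hX0 : dense X0) (hY0 : dense Y0)
  (S : nat -> X -> X)
  (hS : forall n y, Npos n -> Y0 y -> range C (S n y))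
  (hcrit : forall (y : X) (eps : R), Y0 y -> 0 < eps ->
    exists (A : set nat) (delta : D), F A /\
      (forall x, X0 x -> exists B : set nat,
         [/\ family_delta Fam delta B, B `<=` A &
             forall n, B n -> fnorm p (iter n T (C x)) < eps]) /\
      (* z is the sum of the series, an element of R(C) *)
      (exists z : X,
         [/\ range C z,
             (fun N => \sum_(1 <= n < N.+1 | n \in A) S n y) @ \oo --> z &
             forall m, A m -> fnorm p (iter m T z - y) < eps]) /\
      (range C `<=` dom_infty T /\
       forall n, Npos n -> continuous_linear (fun x => iter n T (C x)))) :
  hypercyclic F T /\
  residual [set y : range_space p C | hypercyclic_vector F T (sval y)].
Proof.
have [[A0 FA0] FN _] := upper_furstenberg_family hF.
(* Condition (iv) stands under the quantifiers over [y] and [eps]; some point of [Y0] releases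
   it. *)
have [y0 [_ Y0y0]] : [set: X] `&` Y0 !=set0 by apply: hY0 openT; exists 0.
have [rangeC cT] : range C `<=` dom_infty T /\
    forall n, Npos n -> continuous_linear (fun x => iter n T (C x)).
  by have [A [delta [_ [_ [_ h]]]]] := hcrit y0 1 Y0y0 ltr01.
pose hits V x := [set n | Npos n /\ V (iter n T (C x))].
have dense_hits y n e : Y0 y -> 0 < e -> exists delta, dense
    [set x | family_delta Fam delta (hits (frechet_ball (p := p) n y e) x)].
  move=> Yy e0; have e20 : 0 < e / 2 by rewrite divr_gt0.
  (* Both error terms, from (i) and (iii), will be below [e / 2] in the seminorm [p n]. *)
  have [d d0 hd] := fnorm_lt _ _ _ p n (e / 2) (frechet_seminorm hX) e20.
  have [A [delta [_ [hi [[z [[c _ <-] _ hiii]] _]]]]] := hcrit y d Yy d0.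
  exists delta => O [u Ou] oO.
  have [m [r [r0 rO]]] := open_sub_frechet_ball hX _ _ oO Ou.
  (* With the sum of the series written as [C c], a point [x] of [X0] near [u - c] makes [x + c]
     close to [u]. *)
  have [|x [xb /hi[B [FB BA hB]]]] := hX0 (frechet_ball (p := p) m (u - c) r) _
      (open_frechet_ball hX _ _ _).
    by exists (u - c); exact: frechet_ball_center.
  exists (x + c); split.
    by apply: rO; move: xb; rewrite /frechet_ball /= opprB addrA (addrAC x).
  have [BN _] := FB.
  apply: (family_delta_sub hF) FB _ _ => [j Bj|j []//].
  have Nj : Npos j by exact: BN.
  split=> //; rewrite /frechet_ball /=.
  have -> : iter j T (C (x + c)) = iter j T (C x) + iter j T (C c).
    by have := (cT j Nj).1 1 x c; rewrite /= !scale1r.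
  rewrite -addrA [e]splitr; apply: le_lt_trans ((frechet_seminorm hX n).1 _ _) _.
  by apply: ltrD; apply: hd; [exact: hB | apply: hiii; exact: BA].
have [y [Yy yd]] := frechet_dense_sequence hX Y0 hsep hY0.
pose V (j : nat * nat) := frechet_ball (p := p) j.2 (y j.1) j.2.+1%:R^-1.
have /choice[delta hdelta] (j : nat * nat) : exists delta, dense
    [set x | family_delta Fam delta (hits (V j) x)].
  by apply: dense_hits; [exact: Yy | rewrite invr_gt0].
have [f finj] := countable_injP _ (upper_furstenberg_countable hF).
(* The dependence on [M] is coded by an injection [f] into [nat]; a number
   outside the image of [f] imposes no condition. *)
pose O (j : nat * nat) (m : nat) : set X :=
  [set x | forall nu, f nu = m -> Fam (delta j) nu (hits (V j) x)].
pose U (i : nat) := let j := odflt (0, 0, 0)%N (unpickle i) in O j.1 j.2.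
have hU i : open (U i) /\ dense (U i).
  rewrite /U; case: (odflt _ _) => j m /=; split.
    have [[nu0 fnu0]|nf] := pselect (exists nu, f nu = m); last first.
      have -> : O j m = setT.
        by apply/seteqP; split=> // x _ nu fnu; case: nf; exists nu.
      exact: openT.
    have -> : O j m = [set x | Fam (delta j) nu0 (hits (V j) x)].
      apply/seteqP; split=> x /= hx; first exact: hx.
      by move=> nu fnu; have -> : nu = nu0 by apply: finj; rewrite ?inE // fnu.
    apply: (open_return_set hF); last exact: open_frechet_ball.
    by move=> n /cT[].
  move=> W W0 oW; have [x [Wx [_ hx]]] := hdelta j W W0 oW.
  by exists x; split=> // nu _; exact: hx.
have U_hypercyclic x : (forall i, U i x) -> hypercyclic_vector F T (C x).
  move=> Ux; split; first by apply: rangeC; exists x.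
  move=> W oW [v Wv]; have [n [e [e0 eW]]] := open_sub_frechet_ball hX _ _ oW Wv.
  (* The same [m] bounds the radius of [V (j, m)] and the distance from [v] to [y j], each by
     [e / 2]; [n <= m] then gives [p n <= p m]. *)
  have [m nm me] := invS_lt _ _ n (divr_gt0 e0 (ltr0Sn R 1)).
  have [|w [yb [j _ yw]]] := yd (frechet_ball (p := p) m v m.+1%:R^-1) _
      (open_frechet_ball hX _ _ _).
    by exists v; apply: (frechet_ball_center hX); rewrite invr_gt0.
  rewrite -yw in yb.
  rewrite (upper_furstenberg_decomposition hF); exists (delta (j, m)) => //.
  apply: (family_delta_sub hF _ (hits (V (j, m)) x)) => [|l [Nl Vl]|l []//].
    (* The index [delta (j, m)] is the same for all [nu]; only the code [f nu] varies. *)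
    split=> [l []//|nu]; have := Ux (pickle (j, m, f nu)).
    by rewrite /U pickleK /=; apply.
  split=> //; apply: eW.
  rewrite /V /frechet_ball /= in Vl yb *.
  apply: le_lt_trans (frechet_le hX _ _ _ nm) _.
  apply: le_lt_trans (seminorm_triangle (frechet_seminorm hX m) (y j) _ _) _.
  by rewrite [e]splitr ltrD // (lt_trans _ me).
split.
  by have [x /U_hypercyclic hx] := frechet_baire hX U hU; exists (C x).
(* The image of [U i] in [[R(C)]], since [C] is injective. *)
pose UC i : set (range_space p C) := [set y | forall x, C x = sval y -> U i x].
have UCE i : to_range (p := p) (C := C) @^-1` UC i = U i.
  apply/seteqP; split=> x /=; first exact.
  by move=> Ux x' /Cinj ->.
exists UC => [i|w]; last first.
  have [x <-] := to_range_surj w => hx.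
  by apply: U_hypercyclic => i; exact: hx.
by split; [apply/(open_rangeP hX hC.1 Cinj) | apply: (dense_range hX hC.1 Cinj)];
  rewrite UCE; have [] := hU i.
Qed.
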